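(* The following are equivalent. (i) Every charming (Tychonoff) space is a $D$-space. (ii) Every charming (Tychonoff) space with a dense Lindelöf $\Sigma$ kernel is a $D$-space.
   Context: All spaces are Tychonoff (completely regular and Hausdorff); subsets carry the subspace topology. A space $X$ is a $D$-space if for every neighborhood assignment $\varphi$ (a map assigning to each $x\in X$ an open set $\varphi(x)\ni x$) there is a closed discrete set $D\subseteq X$ with $X=\bigcup_{d\in D}\varphi(d)$. A space $Z$ is Lindelöf $\Sigma$ if there are a second countable Tychonoff space $M$ and a map $\Phi$ from $M$ to the nonempty compact subsets of $Z$ that is upper semicontinuous (for each open $U\subseteq Z$, $\{m\in M:\Phi(m)\subseteq U\}$ is open in $M$) with $Z=\bigcup_{m\in M}\Phi(m)$. A space $X$ is charming if it has a Lindelöf $\Sigma$ subspace $Y$ such that for every open $U\subseteq X$ with $Y\subseteq U$, the subspace $X\setminus U$ is Lindelöf $\Sigma$; such a $Y$ is called a Lindelöf $\Sigma$ kernel of $X$. A dense Lindelöf $\Sigma$ kernel is one that is dense in $X$. *)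

(* Defs.v *)
From mathcomp Require Import all_boot all_order all_algebra.
From mathcomp Require Import all_classical all_reals all_analysis.

Set Implicit Arguments.
Unset Strict Implicit.
Unset Printing Implicit Defensive.

Local Open Scope classical_set_scope.

(* Subspaces are the types [set_type A], which carry the initial topology of the
   inclusion.  The library's [subspace A] is not used: it is a topology on the
   whole ambient type, in which the points outside [A] are isolated. *)

Definition tychonoff_space (X : topologicalType) : Prop :=
  completely_regular_space X /\ hausdorff_space X.

Definition discrete_set (X : topologicalType) (D : set X) : Prop :=
  forall A : set (set_type D), open A.

Definition neighborhood_assignment (X : topologicalType)
    (phi : X -> set X) : Prop :=
  forall x, open (phi x) /\ phi x x.

Definition D_space (X : topologicalType) : Prop :=
  forall phi : X -> set X, neighborhood_assignment phi ->
  exists D : set X,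
    [/\ closed D, discrete_set D & \bigcup_(d in D) phi d = [set: X]].

Definition upper_semicontinuous (M Z : topologicalType)
    (Phi : M -> set Z) : Prop :=
  forall U : set Z, open U -> open [set m | Phi m `<=` U].

Definition lindelof_sigma (Z : topologicalType) : Prop :=
  exists (M : topologicalType) (Phi : M -> set Z),
    [/\ tychonoff_space M /\ @second_countable M,
        forall m, Phi m !=set0 /\ compact (Phi m),
        upper_semicontinuous Phi
      & \bigcup_m Phi m = [set: Z]].

Definition lindelof_sigma_kernel (X : topologicalType) (Y : set X) : Prop :=
  lindelof_sigma (set_type Y) /\
  forall U : set X, open U -> Y `<=` U -> lindelof_sigma (set_type (~` U)).

Definition charming (X : topologicalType) : Prop :=
  exists Y : set X, lindelof_sigma_kernel Y.

(* Main.v *)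
(* Let Y be a Lindelof Sigma kernel of X, and let Z be the closure of Y.  Then Z
   is charming with dense kernel Y, hence a D-space; once a closed discrete
   subset of Z has taken care of Z, the uncovered part of X is a closed set
   missing Y, hence Lindelof Sigma.  That part needs no theorem on Lindelof Sigma
   spaces being D-spaces: such a space is its own dense Lindelof Sigma kernel, so
   (ii) applies to it. *)

Require Import Defs.
From mathcomp Require Import all_boot all_order all_algebra.
From mathcomp Require Import all_classical all_reals all_analysis.

Local Open Scope classical_set_scope.

Lemma set_val_continuous (X : topologicalType) (A : set X) :
  continuous (set_val : A -> X).
Proof. exact: initial_continuous. Qed.

(** The separating uniformity of [T] is pulled back along [f]. Continuity of [f] keeps the
    pulled-back uniformity coarser than the topology of [S]. *)
Lemma uniform_separator_preimage (S T : topologicalType) (f : S -> T)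
    (A B : set T) : continuous f ->
  uniform_separator A B -> uniform_separator (f @^-1` A) (f @^-1` B).
Proof.
move=> cf [uT [E [entE ABE0 coarse]]].
pose UT := Uniform.Pack uT.
exists (Uniform.class (initial_topology (f : S -> UT))).
exists [set xy | E (f xy.1, f xy.2)]; split.
- by exists E.
- rewrite -subset0 => -[x y] [[/= Ax By] Exy].
  by rewrite -[False]/(set0 (f x, f y)) -ABE0.
- move=> x V [_ [[W oW <-] Wx WV]].
  apply: (filterS WV); apply: cf; apply: coarse.
  exact: (@open_nbhs_nbhs UT).
Qed.

Lemma tychonoff_subspace (X : topologicalType) (A : set X) :
  tychonoff_space X -> tychonoff_space (set_type A).
Proof.
move=> [crX hX]; split.
- move=> a B clB nBa.
  have /= [W oW WB] : open (~` B) by exact: closed_openC.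
  have Wa : W (set_val a) by rewrite -[W _]/((set_val @^-1` W) a) WB.
  have /(crX (set_val a)) : closed (~` W) by exact: open_closedC.
  move=> /(_ (fun h => h Wa)).
  move=> /(@uniform_separator_preimage (set_type A) _ set_val).
  move=> /(_ (@set_val_continuous X A)) [uT [E [entE disj coarse]]].
  exists uT, E; split => //.
  rewrite -subset0 => -[x y] [[/= -> By] Exy].
  rewrite -[False]/(set0 (a, y)) -disj; split => //; split => //= Wy.
  by have : (~` B) y by rewrite -WB.
- move=> p q pq; apply: val_inj; apply: hX => U V pU qV.
  have [r [Ur Vr]] := pq _ _ (@set_val_continuous X A p U pU) (@set_val_continuous X A q V qV).
  by exists (set_val r).
Qed.

(** The same [M] works: [f] maps compact values to compact values, and [f @] Phi
    m[lies in]U[exactly when]Phi m[lies in the open set]f @^-1[U]. *)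
Lemma lindelof_sigma_image (S T : topologicalType) (f : S -> T) :
  continuous f -> range f = [set: T] -> lindelof_sigma S -> lindelof_sigma T.
Proof.
move=> cf fT [M [Phi [tM cPhi uPhi covPhi]]].
exists M, (fun m => f @` Phi m); split => //.
- move=> m; have [[z Pz] cP] := cPhi m; split; first by exists (f z), z.
  apply: continuous_compact => //; exact: continuous_subspaceT.
- move=> U oU.
  rewrite (_ : [set m | _] = [set m | Phi m `<=` f @^-1` U]).
    by apply: uPhi; move/continuousP: cf; exact.
  by rewrite predeqE => m; split => [h x Px|h _ [x Px <-]]; apply: h => //; exists x.
- rewrite -subTset => t _; have : [set: T] t by [].
  rewrite -fT => -[z _ <-].
  have : [set: S] z by [].
  by rewrite -covPhi => -[m _ Pz]; exists m => //; exists z.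
Qed.

(** A subspace of a subspace is a different type from the corresponding subspace of [X]. The points
    match up, and both topologies consist of traces of open sets of [X], so the matching is a
    continuous surjection from [A] onto [B]. *)
Lemma lindelof_sigma_subspace_trans (X : topologicalType) (A Z : set X)
    (B : set (set_type Z)) :
  set_val @` B = A -> lindelof_sigma (set_type A) ->
  lindelof_sigma (set_type B).
Proof.
move=> BA; have /choice [f fE] (a : A) :
    exists b : B, set_val (set_val b) = set_val a.
  have [z Bz <-] : (set_val @` B) (set_val a) by rewrite BA; exact: set_valP.
  by exists (SigSub (mem_set Bz)).
apply: (@lindelof_sigma_image _ _ f).
- apply/continuousP => _ [_ [W oW <-] <-].
  by exists W => //; rewrite predeqE => a /=; rewrite fE.
- rewrite -subTset => b _.
  have Ab : A (set_val (set_val b)).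
    by rewrite -BA; exists (set_val b) => //; exact: set_valP.
  by exists (SigSub (mem_set Ab)) => //; do 2 apply: val_inj; exact: fE.
Qed.

(** Nonempty values in an empty [Z] force [M] to be empty, so [Z] itself serves as [M]. *)
Lemma lindelof_sigma_empty (Z : topologicalType) :
  (Z -> False) -> lindelof_sigma Z.
Proof.
move=> Z0; exists Z, (fun=> set0); split.
- split; first by split => z; case: (Z0 z).
  by exists set0 => //; split => // z; case: (Z0 z).
- by move=> m; case: (Z0 m).
- move=> U _; rewrite (_ : [set _ | _] = setT); first exact: openT.
  by rewrite predeqE => m; case: (Z0 m).
- by rewrite predeqE => z; case: (Z0 z).
Qed.

Lemma lindelof_sigma_kernelT (Z : topologicalType) :
  lindelof_sigma Z -> lindelof_sigma_kernel [set: Z].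
Proof.
move=> lZ; split.
- pose f (z : Z) : [set: Z] := SigSub (mem_set (I : [set: Z] z)).
  apply: (@lindelof_sigma_image _ _ f) lZ.
  + by apply/continuousP => _ [W oW <-].
  + by rewrite -subTset => z _; exists (set_val z) => //; exact: val_inj.
(* An open set containing the whole space leaves an empty remainder. *)
- move=> U _ UT; apply: lindelof_sigma_empty => z.
  by have := set_valP z; apply; exact: UT.
Qed.

Lemma lindelof_sigma_kernel_closed (X : topologicalType) (Y Z : set X) :
  closed Z -> Y `<=` Z -> lindelof_sigma_kernel Y ->
  lindelof_sigma_kernel (set_val @^-1` Y : set (set_type Z)).
Proof.
move=> clZ YZ [lY kY]; split.
- apply: lindelof_sigma_subspace_trans lY; rewrite eqEsubset; split.
    by move=> _ [z Yz <-].
  by move=> y Yy; exists (SigSub (mem_set (YZ _ Yy))).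
- move=> _ [W oW <-] YW.
  apply: (@lindelof_sigma_subspace_trans _ (~` (W `|` ~` Z))).
    rewrite setCU setCK eqEsubset; split.
      by move=> _ [z Wz <-]; split => //; exact: set_valP.
    by move=> x [nWx Zx]; exists (SigSub (mem_set Zx)).
  apply: kY; first by apply: openU => //; exact: closed_openC.
  by move=> y Yy; left; exact: (YW (SigSub (mem_set (YZ _ Yy)))).
Qed.

Lemma dense_in_closure (X : topologicalType) (Y : set X) :
  dense (set_val @^-1` Y : set (set_type (closure Y))).
Proof.
move=> V [z Vz] [W oW WV]; rewrite -{}WV {V} in Vz *.
have [y [Yy Wy]] := set_valP z _ (open_nbhs_nbhs (conj oW Vz)).
by exists (SigSub (mem_set (subset_closure Yy))).
Qed.

(** This form speaks of points and open sets of [X] only, so discreteness can be moved between [X]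
    and its subspaces. *)
Lemma discrete_setP (X : topologicalType) (D : set X) :
  discrete_set D <->
  forall x, D x -> exists2 W, open W /\ W x & forall y, W y -> D y -> y = x.
Proof.
split=> [dD x Dx|dD A].
- have [W oW WE] := dD [set SigSub (mem_set Dx)].
  exists W.
    split=> //.
    by rewrite -[W x]/((set_val @^-1` W) (SigSub (mem_set Dx))) WE.
  move=> y Wy Dy.
  have : (set_val @^-1` W) (SigSub (mem_set Dy)) by [].
  by rewrite WE => /(congr1 val).
- rewrite openE => a Aa; have [W [oW Wa] Weq] := dD _ (set_valP a).
  exists (set_val @^-1` W); split => //; first by exists W.
  move=> b Wb; suff -> : b = a by [].
  by apply: val_inj; apply: Weq => //; exact: set_valP.
Qed.

(** A point of one set that lies outside the other has a neighborhood missing the other, by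
    closedness; at a common point the two isolating neighborhoods are intersected. *)
Lemma discrete_setU (X : topologicalType) (D E : set X) :
  closed D -> closed E -> discrete_set D -> discrete_set E ->
  discrete_set (D `|` E).
Proof.
have isolated (A B : set X) x : closed B -> discrete_set A -> discrete_set B ->
    A x -> exists2 W, open W /\ W x & forall y, W y -> (A `|` B) y -> y = x.
  move=> clB /discrete_setP dA /discrete_setP dB Ax.
  have [V [oV Vx] VA] := dA x Ax.
  have [/dB [W [oW Wx] WB]|nBx] := pselect (B x).
    exists (V `&` W); first by split => //; exact: openI.
    by move=> y [Vy Wy] [/(VA _ Vy)|/(WB _ Wy)].
  exists (V `&` ~` B); first by split => //; apply: openI => //; exact: closed_openC.
  by move=> y [Vy nBy] [/(VA _ Vy)|].
move=> clD clE dD dE; apply/discrete_setP => x [Dx|Ex].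
- exact: isolated.
- by rewrite setUC; exact: isolated.
Qed.

Lemma D_space_closed_cover (X : topologicalType) (A : set X)
    (phi : X -> set X) :
  closed A -> D_space (set_type A) -> neighborhood_assignment phi ->
  exists D : set X,
    [/\ closed D, discrete_set D & A `<=` \bigcup_(d in D) phi d].
Proof.
move=> clA DA nphi.
have [|D [clD /discrete_setP dD covD]] :=
    DA (fun a => set_val @^-1` phi (set_val a)).
  by move=> a; have [ophi phia] := nphi (set_val a); split => //; exists (phi (set_val a)).
exists (set_val @` D); split.
- have /= [W oW WE] : open (~` D) by exact: closed_openC.
  (* A relatively closed subset of the closed set [A] is closed in [X]. *)
  rewrite (_ : _ @` _ = A `&` ~` W).
    by apply: closedI => //; exact: open_closedC.
  rewrite eqEsubset; split.
    move=> _ [d Dd <-]; split; first exact: set_valP.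
    by move=> Wd; have : (~` D) d by rewrite -WE.
  move=> x [Ax nWx]; exists (SigSub (mem_set Ax)) => //.
  by apply: contrapT => nD; apply: nWx; move: nD; rewrite -[~ _]/((~` D) _) -WE.
- apply/discrete_setP => _ [d Dd <-].
  have [_ [[W oW <-] Wd] Weq] := dD d Dd.
  by exists W => // y + [z Dz zy]; rewrite -zy => Wz; rewrite (Weq z).
- move=> x Ax; have : [set: A] (SigSub (mem_set Ax)) by [].
  by rewrite -covD => -[d Dd pd]; exists (set_val d) => //; exists d.
Qed.

Theorem theorem3p15 :
  (forall X : topologicalType,
     tychonoff_space X -> charming X -> D_space X)
  <->
  (forall X : topologicalType,
     tychonoff_space X -> charming X ->
     (exists Y : set X, lindelof_sigma_kernel Y /\ dense Y) ->
     D_space X).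
Proof.
split=> [H X tX cX _|H X tX [Y kY] phi nphi]; first exact: H.
(* A single [K] witnesses both that [Z] is charming and that it has a dense kernel. *)
have H' (Z : topologicalType) (K : set Z) :
    tychonoff_space Z -> lindelof_sigma_kernel K -> dense K -> D_space Z.
  by move=> tZ kK dK; apply: H => //; exists K.
have DZ : D_space (set_type (closure Y)).
  apply: (H' _ (set_val @^-1` Y)); first exact: tychonoff_subspace.
  + apply: lindelof_sigma_kernel_closed => //; first exact: closed_closure.
    exact: subset_closure.
  + exact: dense_in_closure.
have [D [clD dD covD]] :=
  D_space_closed_cover _ _ phi (@closed_closure _ Y) DZ nphi.
set U := \bigcup_(d in D) phi d in covD.
have oU : open U by apply: bigcup_open => d _; have [] := nphi d.
have DU : D_space (set_type (~` U)).
  apply: (H' _ setT); first exact: tychonoff_subspace.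
  + apply: lindelof_sigma_kernelT; apply: kY.2 => //.
    by apply: subset_trans covD; exact: subset_closure.
  + by move=> O [x Ox] _; exists x.
(* [D] takes care of [U] and [E] of its complement; both are closed and discrete in [X], hence so is
   their union. *)
have [E [clE dE covE]] := D_space_closed_cover _ _ phi (open_closedC oU) DU nphi.
exists (D `|` E); split.
- exact: closedU.
- exact: discrete_setU.
- rewrite bigcup_setU -subTset => x _.
  by have [Ux|/covE] := pselect (U x); [left|right].
Qed.
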